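(* Let $G$ be a connected graph of order $n\ge 2$. Then $Z_g(G)=2$ if and only if $G$ admits an alternating two-chain forcing schedule.
   Context: All graphs are finite and simple. Alternating two-chain forcing schedule: $G$ admits one if its vertices have an ordered partition $V(G)=\{a_1,\ldots,a_p\}\mathbin{\dot\cup}\{b_1,\ldots,b_q\}$ with $p=\lceil |V(G)|/2\rceil$, $q=\lfloor |V(G)|/2\rfloor$, such that, starting with all vertices white, after Alice seeds (colours) $a_1$ and Bob seeds (colours) $b_1$, the remaining vertices can be coloured in the turn order $a_2,b_2,a_3,b_3,\ldots$ (truncated after all vertices are coloured), where $a_i$ is the unique white neighbour of $a_{i-1}$ immediately before Alice's corresponding turn and $b_i$ is the unique white neighbour of $b_{i-1}$ immediately before Bob's corresponding turn. The game: Let $G$ be a connected graph with at least one edge; initially all vertices are white. Alice (blue) and Bob (red) alternate turns, Alice first. On each turn the player makes exactly one move: a seed move (colour one white vertex with the player's colour) or a force move $u\to v$ (if a vertex $u$ of the player's colour has exactly one white neighbour $v$, colour $v$ with the player's colour). Being the unique white neighbour is with respect to all white vertices, irrespective of who coloured the others. If a white vertex is the target of one of the player's own legal forces, colouring it counts as a force move and not as a seed move. A move blocks a legal force $u\to v$ if that force is no longer legal after the move. Force Preservation Rule: considering the opponent's legal forces (those the opponent's coloured vertices could make) at the beginning of a turn, (i) a player may always perform one of their own legal forces, even if this blocks a force of the opponent; (ii) a seed move that blocks a legal force of the opponent is permitted only when every available seed move blocks at least one of the opponent's legal forces. The game ends when every vertex is coloured. Optimal play and $Z_g$: For a position $P$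 define a set $\mathcal O(P)$ of pairs. If $P$ is terminal and Alice and Bob made $s_A$ and $s_B$ seed moves in total, then $\mathcal O(P)=\{(s_A,s_B)\}$. Otherwise let $\mathcal U(P)=\bigcup_m \mathcal O(P_m)$ over all legal moves $m$, where $P_m$ is the resulting position; $\mathcal O(P)$ is the set of all pairs in $\mathcal U(P)$ with minimum first coordinate if Alice is to move, and with minimum second coordinate if Bob is to move. Let $\mathcal O(G)=\mathcal O(P_0(G))$ for the initial position $P_0(G)$. The game zero forcing number is $Z_g(G)=\min\{s_A+s_B:(s_A,s_B)\in\mathcal O(G)\}$. *)

(* Defs.v *)
From mathcomp Require Import all_boot.

Set Implicit Arguments.
Unset Strict Implicit.
Unset Printing Implicit Defensive.

Record sgraph := SGraph {
  vertex :> finType;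
  adj : rel vertex;
  adj_sym : symmetric adj;
  adj_irrefl : irreflexive adj }.

Definition connected_graph (G : sgraph) : Prop :=
  forall x y : G, connect (@adj G) x y.

Definition unique_white_nbr (G : sgraph) (W : {set G}) (u v : G) : bool :=
  [set x in W | adj u x] == [set v].

(* a and b list a_1, ..., a_p and b_1, ..., b_q, so that nth x0 a i is a_(i+1).
   Just before Alice colours nth x0 a i, the first i entries of a and of b are
   coloured; just before Bob colours nth x0 b i, the first i.+1 entries of a
   and the first i entries of b are.  The value of x0 is irrelevant since all
   indices are in range. *)
Definition alternating_two_chain_schedule (G : sgraph) (a b : seq G) : Prop :=
  [/\ perm_eq (a ++ b) (enum (vertex G)),
      size a = uphalf #|vertex G|,
      size b = #|vertex G|./2,
      forall (x0 : G) (i : nat), 0 < i < size a ->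
        unique_white_nbr [set x | x \notin take i a ++ take i b]
          (nth x0 a i.-1) (nth x0 a i)
    & forall (x0 : G) (i : nat), 0 < i < size b ->
        unique_white_nbr [set x | x \notin take i.+1 a ++ take i b]
          (nth x0 b i.-1) (nth x0 b i)].

Definition admits_alternating_two_chain_schedule (G : sgraph) : Prop :=
  exists a b : seq G, alternating_two_chain_schedule a b.

Variant player := Alice | Bob.

Definition opponent (c : player) : player := if c is Alice then Bob else Alice.

(* seedsA and seedsB count the seed moves made so far. *)
Record position (G : sgraph) := Position {
  blue : {set G};
  red : {set G};
  turn : player;
  seedsA : nat;
  seedsB : nat }.

Variant move (G : sgraph) := Seed of G | Force of G & G.

Section Game.
Variable G : sgraph.
Implicit Types (P : position G) (c : player) (u v w : G).

Definition initial : position G := Position set0 set0 Alice 0 0.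

Definition own P c : {set G} := if c is Alice then blue P else red P.

Definition white P : {set G} := ~: (blue P :|: red P).

Definition terminal P : bool := white P == set0.

Definition legal_force P c u v : bool :=
  (u \in own P c) && unique_white_nbr (white P) u v.

Definition play P (m : move G) : position G :=
  let: (v, s) := match m with Seed v => (v, 1) | Force _ v => (v, 0) end in
  if turn P is Alice
  then Position (v |: blue P) (red P) Bob (seedsA P + s) (seedsB P)
  else Position (blue P) (v |: red P) Alice (seedsA P) (seedsB P + s).

Definition blocks P (m : move G) u v : bool :=
  legal_force P (opponent (turn P)) u v &&
  ~~ legal_force (play P m) (opponent (turn P)) u v.

Definition blocks_some P (m : move G) : bool :=
  [exists u, exists v, blocks P m u v].

(* A white vertex that the player can force is not available as a seed. *)
Definition available_seed P v : bool :=
  (v \in white P) && ~~ [exists u, legal_force P (turn P) u v].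

Definition legal_move P (m : move G) : bool :=
  match m with
  | Seed v =>
      available_seed P v &&
      (blocks_some P (Seed v) ==>
         [forall w, available_seed P w ==> blocks_some P (Seed w)])
  | Force u v => legal_force P (turn P) u v
  end.

Definition all_moves : seq (move G) :=
  [seq Seed v | v <- enum (vertex G)] ++
  [seq Force u v | u <- enum (vertex G), v <- enum (vertex G)].

Definition coord c (p : nat * nat) : nat := if c is Alice then p.1 else p.2.

Definition minimizers c (U : seq (nat * nat)) : seq (nat * nat) :=
  [seq p <- U | all (fun q => coord c p <= coord c q) U].

(* Sets of pairs are represented by sequences, up to membership.  The bound k
   on the number of remaining moves only serves termination: each legal move
   colours exactly one white vertex, so #|white P| is enough (outcomesE). *)
Fixpoint outcomes_rec (k : nat) P : seq (nat * nat) :=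
  if terminal P then [:: (seedsA P, seedsB P)]
  else if k is k'.+1 then
    minimizers (turn P)
      (flatten [seq outcomes_rec k' (play P m) | m <- all_moves & legal_move P m])
  else [::].

Definition outcomes P : seq (nat * nat) := outcomes_rec #|white P| P.

Lemma white_play P m : legal_move P m ->
  #|white P| = #|white (play P m)|.+1.
Proof.
pose tgt := match m with Seed v => v | Force _ v => v end.
have -> : white (play P m) = white P :\ tgt.
  rewrite /white /play /tgt.
  by case: m {tgt} => [v|u v]; case: (turn P); apply/setP => x;
     rewrite !inE /= ?negb_or; do ![case: (_ \in _) | case: (_ == _)].
move=> legm; suff wt : tgt \in white P by rewrite (cardsD1 tgt) wt.
case: m @tgt legm => [v|u v] /=; first by case/andP => /andP[].
by case/andP => _ /eqP/setP/(_ v); rewrite !inE eqxx => /andP[].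
Qed.

Lemma outcomesE P :
  outcomes P =
    if terminal P then [:: (seedsA P, seedsB P)]
    else minimizers (turn P)
           (flatten [seq outcomes (play P m) | m <- all_moves & legal_move P m]).
Proof.
rewrite {1}/outcomes; case Dk: #|white P| => [|k] /=.
  by rewrite /terminal -cards_eq0 Dk.
case: (terminal P) => //; congr (minimizers _ (flatten _)).
elim: all_moves => //= m s IHs; case: ifP => //= /white_play.
by rewrite Dk IHs /outcomes => -[->].
Qed.

Lemma minimizers_neq0 c U : U != [::] -> minimizers c U != [::].
Proof.
case: U => // p0 U _; set V := p0 :: U.
have exV : exists n, has (fun p => coord c p == n) V.
  by exists (coord c p0); rewrite /= eqxx.
case: (ex_minnP exV) => n /hasP[p pV /eqP Dp] n_min.
suff: p \in minimizers c V by case: (minimizers c V).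
rewrite mem_filter pV andbT; apply/allP => q qV; rewrite Dp.
by apply: n_min; apply/hasP; exists q.
Qed.

Lemma has_legal_move P : ~~ terminal P -> has (legal_move P) all_moves.
Proof.
case/set0Pn => w0 w0W; rewrite has_cat has_map.
have [[u /existsP[v Fuv]]|noF] :=
    altP (@existsP _ (fun u => [exists v, legal_force P (turn P) u v])).
  apply/orP; right; have := mem_enum (vertex G) u; rewrite inE.
  elim: {1 3}(enum (vertex G)) => //= x s IHs; rewrite has_cat inE.
  case/predU1P => [<-|/IHs -> ]; last exact: orbT.
  by rewrite has_map; apply/orP; left; apply/hasP; exists v; rewrite ?mem_enum.
have avail w : w \in white P -> available_seed P w.
  move=> wW; rewrite /available_seed wW; apply: contra noF => /existsP[u Fuw].
  by apply/existsP; exists u; apply/existsP; exists w.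
apply/orP; left; apply/hasP.
have [/forallP allB|] :=
    boolP [forall w, available_seed P w ==> blocks_some P (Seed w)].
  exists w0; rewrite ?mem_enum //= avail // implybE.
  by apply/orP; right; apply/forallP.
rewrite negb_forall => /existsP[w]; rewrite negb_imply => /andP[Aw nBw].
by exists w; rewrite ?mem_enum //= Aw (negPf nBw).
Qed.

Lemma outcomes_neq0 P : outcomes P != [::].
Proof.
have [k] := ubnP #|white P|; elim: k P => // k IHk P leWk.
rewrite outcomesE; case: ifPn => // /has_legal_move hasm.
apply: minimizers_neq0; elim: all_moves hasm => //= m s IHs.
case: ifP => [/white_play Dw _ | _ /IHs //].
have /= := IHk (play P m).
by rewrite -ltnS -Dw => /(_ leWk); case: (outcomes (play P m)).
Qed.

End Game.

(* The minimum of a nonempty sequence; outcomes_neq0 shows that it is only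
   applied to such sequences below. *)
Definition seq_min (s : seq nat) : nat := foldr minn (head 0 s) s.

Definition Zg (G : sgraph) : nat :=
  seq_min [seq p.1 + p.2 | p <- outcomes (initial G)].

(* Main.v *)
Require Import Defs.
From HB Require Import structures.
From mathcomp Require Import all_boot zify.

(* Both players have to open with a seed, so every outcome is at least (1, 1) in
   each coordinate, and Zg G = 2 means that some optimal line uses forces only
   after the openings.  A vertex that has forced has no white neighbour left,
   hence in such a line only the last vertex a player coloured can force: the
   line is a pair of alternating chains.  Conversely, (1, 1) is the least
   possible value of both coordinates, so once it is reachable by legal moves no
   minimisation discards it; the only legality issue is the opening seed of Bob,
   which blocks no force because a_1 still has to force a_2 (on two vertices it is
   the only available seed). *)

Set Implicit Arguments.
Unset Strict Implicit.
Unset Printing Implicit Defensive.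

(** * Splitting a sequence into its two alternating subsequences *)

Section Alternate.
Variable T : Type.
Implicit Types (s : seq T) (x : T).

Fixpoint evens s : seq T :=
  if s is x :: s1 then x :: (if s1 is _ :: s2 then evens s2 else [::]) else [::].

(** Taking [evens] of the tail makes prefixing an entry exchange the roles of [evens] and [odds], so
    facts about the two are proved jointly by a plain induction. *)
Definition odds s : seq T := evens (behead s).

Lemma evens_cons x s : evens (x :: s) = x :: odds s.
Proof. by case: s. Qed.

Lemma odds_cons x s : odds (x :: s) = evens s.
Proof. by []. Qed.

Lemma size_evens_odds s :
  size (evens s) = uphalf (size s) /\ size (odds s) = (size s)./2.
Proof.
by elim: s => // x s [IHe IHo]; rewrite evens_cons odds_cons /= IHe IHo.
Qed.

Lemma size_evens s : size (evens s) = uphalf (size s).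
Proof. by have [] := size_evens_odds s. Qed.

Lemma size_odds s : size (odds s) = (size s)./2.
Proof. by have [] := size_evens_odds s. Qed.

Lemma nth_evens_odds x0 s i :
  nth x0 (evens s) i = nth x0 s i.*2 /\ nth x0 (odds s) i = nth x0 s i.*2.+1.
Proof.
elim: s i => [|x s IHs] i; first by rewrite !nth_nil.
rewrite evens_cons odds_cons; split; last by have [] := IHs i.
by case: i => //= i; have [] := IHs i.
Qed.

Lemma nth_evens x0 s i : nth x0 (evens s) i = nth x0 s i.*2.
Proof. by have [] := nth_evens_odds x0 s i. Qed.

Lemma nth_odds x0 s i : nth x0 (odds s) i = nth x0 s i.*2.+1.
Proof. by have [] := nth_evens_odds x0 s i. Qed.

Lemma take_evens_odds k s :
  evens (take k s) = take (uphalf k) (evens s) /\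
  odds (take k s) = take k./2 (odds s).
Proof.
elim: s k => [|x s IHs] [|k]; rewrite ?take0 //.
rewrite [take _ _]/= !evens_cons !odds_cons.
by have [-> ->] := IHs k.
Qed.

Lemma evens_odds_rcons s x :
  evens (rcons s x) = (if odd (size s) then evens s else rcons (evens s) x) /\
  odds (rcons s x) = (if odd (size s) then rcons (odds s) x else odds s).
Proof.
elim: s => [|y s [IHe IHo]] //.
by rewrite rcons_cons !evens_cons !odds_cons IHe IHo /=; case: odd.
Qed.

(** Removing the head of [a] and swapping the two sequences preserves the size condition, whence the
    induction on the total size. *)
Lemma evens_odds_surj (a b : seq T) :
  size b <= size a <= (size b).+1 -> exists s, evens s = a /\ odds s = b.
Proof.
have [n] := ubnP (size a + size b); elim: n a b => // n IHn [|x a] b /=.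
  by case: b => // _ _; exists [::].
rewrite addSn ltnS addnC => lt_ab_n /andP[le_b_a le_a_b].
have [|s [De Do]] := IHn b a lt_ab_n; first by rewrite -ltnS le_a_b.
by exists (x :: s); rewrite evens_cons odds_cons De Do.
Qed.

End Alternate.

Lemma perm_evens_odds (T : eqType) (s : seq T) : perm_eq (evens s ++ odds s) s.
Proof.
elim: s => // x s IHs; rewrite evens_cons odds_cons cat_cons perm_cons.
by rewrite perm_catC.
Qed.

Lemma mem_evens_odds (T : eqType) (s : seq T) x :
  (x \in s) = (x \in evens s) || (x \in odds s).
Proof. by rewrite -mem_cat (perm_mem (perm_evens_odds s)). Qed.

Lemma seq_min_mem s : s != [::] -> seq_min s \in s.
Proof.
case: s => // x s _; rewrite /seq_min /=.
suff sF : foldr minn x s \in x :: s.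
  by rewrite /minn; case: ifP; rewrite // mem_head.
elim: s => [|y s IHs] /=; first by rewrite mem_head.
rewrite /minn; case: ifP => _; first by rewrite !inE eqxx orbT.
by move: IHs; rewrite !inE => /orP[] ->; rewrite ?orbT.
Qed.

Lemma seq_min_le s x : x \in s -> seq_min s <= x.
Proof.
rewrite /seq_min; elim: s (head 0 s) => //= y s IHs z.
rewrite inE geq_min => /predU1P[-> | /IHs->]; by rewrite ?leqnn ?orbT.
Qed.

Section MoveEq.
Variable G : sgraph.

(** The coding transfers an equality structure to moves, so that membership in [all_moves] makes
    sense. *)
Definition move_code (m : move G) : G + G * G :=
  match m with Seed v => inl v | Force u v => inr (u, v) end.
Definition move_decode (c : G + G * G) : move G :=
  match c with inl v => Seed v | inr (u, v) => Force u v end.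
Lemma move_codeK : cancel move_code move_decode.
Proof. by case. Qed.

HB.instance Definition _ := Equality.copy (move G) (can_type move_codeK).

End MoveEq.

(** * Optimal outcomes and seed counts *)

Section Play.
Variable G : sgraph.
Implicit Types (P : position G) (m : move G) (s t : seq G) (u v w x : G).
Implicit Types p q : nat * nat.

Lemma mem_all_moves m : m \in all_moves G.
Proof.
rewrite mem_cat; case: m => [v|u v]; apply/orP; [left | right].
  by apply: map_f; rewrite mem_enum.
by apply: allpairs_f; rewrite mem_enum.
Qed.

Lemma mem_outcomes P p : ~~ terminal P ->
  reflect ((exists2 m, legal_move P m & p \in outcomes (play P m)) /\
           forall m q, legal_move P m -> q \in outcomes (play P m) ->
             coord (turn P) p <= coord (turn P) q)
          (p \in outcomes P).
Proof.
rewrite outcomesE => /negPf->; rewrite mem_filter andbC.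
apply: (iffP andP) => [[/flatten_mapP[m]] | [[m Lm pm] p_min]].
  rewrite mem_filter => /andP[Lm _] pm /allP p_min; split; first by exists m.
  move=> m1 q Lm1 qm1; apply: p_min; apply/flatten_mapP; exists m1 => //.
  by rewrite mem_filter Lm1 mem_all_moves.
split.
  by apply/flatten_mapP; exists m; rewrite // mem_filter Lm mem_all_moves.
apply/allP => q /flatten_mapP[m1]; rewrite mem_filter => /andP[Lm1 _].
exact: p_min.
Qed.

Lemma seeds_play P m :
  seedsA P <= seedsA (play P m) /\ seedsB P <= seedsB (play P m).
Proof.
by case: m => [v|u v]; rewrite /play; case: (turn P); rewrite /= ?leq_addr.
Qed.

Lemma outcomes_ge P p :
  p \in outcomes P -> seedsA P <= p.1 /\ seedsB P <= p.2.
Proof.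
have [k] := ubnP #|white P|; elim: k P => // k IHk P leWk.
have [tP | ntP] := boolP (terminal P).
  by rewrite outcomesE tP inE => /eqP->.
case/(mem_outcomes _ ntP) => [[m Lm /IHk[]]].
  by rewrite -ltnS -(white_play Lm).
by have [leA leB] := seeds_play P m => /(leq_trans leA)? /(leq_trans leB)?.
Qed.

(** * Positions coded by the order in which the vertices were coloured *)

Definition state s (sA sB : nat) : position G :=
  Position [set x in evens s] [set x in odds s]
           (if odd (size s) then Bob else Alice) sA sB.

Lemma initial_state : initial G = state [::] 0 0.
Proof.
by rewrite /initial /state /=; congr Position; apply/setP => x; rewrite !inE.
Qed.

Lemma white_state s sA sB : white (state s sA sB) = [set x | x \notin s].
Proof. by apply/setP => x; rewrite !inE (mem_evens_odds s). Qed.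

Lemma terminal_state s sA sB :
  reflect (forall x, x \in s) (terminal (state s sA sB)).
Proof.
rewrite /terminal white_state; apply: (iffP eqP) => [/setP s_all x | s_all].
  by have:= s_all x; rewrite !inE => /negbFE.
by apply/setP => x; rewrite !inE s_all.
Qed.

Lemma play_force s sA sB u v :
  play (state s sA sB) (Force u v) = state (rcons s v) sA sB.
Proof.
rewrite /state /play size_rcons /=; have [-> ->] := evens_odds_rcons s v.
by case: odd; rewrite /= addn0; congr Position; apply/setP => x;
  rewrite !inE ?mem_rcons ?inE.
Qed.

Lemma play_seed s sA sB v :
  play (state s sA sB) (Seed v) =
    state (rcons s v) (sA + ~~ odd (size s)) (sB + odd (size s)).
Proof.
rewrite /state /play size_rcons /=; have [-> ->] := evens_odds_rcons s v.
by case: odd; rewrite /= ?addn0; congr Position; apply/setP => x;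
  rewrite !inE ?mem_rcons ?inE.
Qed.

(** A player moves at every second turn, and the next index to be filled is [size s]; so the
    vertices of the player to move sit at the indices of that parity. *)
Lemma own_state x0 s sA sB u :
  reflect (exists i, [/\ i < size s, odd i = odd (size s) & nth x0 s i = u])
          (u \in own (state s sA sB) (turn (state s sA sB))).
Proof.
rewrite /own /=; move Dn: (size s) => n; case odd_n: (odd n); rewrite /= inE;
  apply: (iffP (nthP x0)) => [[i] | [i [lt_i odd_i Du]]].
- rewrite size_odds nth_odds Dn => lt_i <-; exists i.*2.+1; split=> //; lia.
- exists i./2; rewrite ?size_odds ?nth_odds ?Dn; first lia.
  by rewrite -Du; congr nth; lia.
- rewrite size_evens nth_evens Dn => lt_i <-; exists i.*2; split=> //; lia.
exists i./2; rewrite ?size_evens ?nth_evens ?Dn; first lia.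
by rewrite -Du; congr nth; lia.
Qed.

(** * Forcing orders and lines of play without further seeds *)

(* s interleaves the two chains: two turns earlier is the same player's previous
   move. *)
Definition forcing_order s : Prop :=
  uniq s /\ forall (x0 : G) k, k.+2 < size s ->
    unique_white_nbr [set x | x \notin take k.+2 s] (nth x0 s k) (nth x0 s k.+2).

Lemma unique_white_nbrP (W : {set G}) u v :
  reflect (forall x, (x \in W) && adj u x = (x == v)) (unique_white_nbr W u v).
Proof.
apply: (iffP eqP) => [/setP eqW x | eqW]; last apply/setP => x.
  by have:= eqW x; rewrite !inE.
by rewrite !inE eqW.
Qed.

(** The forcing vertex can only be the one coloured two turns earlier: any older vertex of that
    player has already used up its last white neighbour. *)
Lemma forcing_order_rcons s v u sA sB : forcing_order s ->
  legal_move (state s sA sB) (Force u v) -> forcing_order (rcons s v).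
Proof.
move=> [Us Fs] /andP[/(own_state u)[j [lt_j odd_j Dj]]].
rewrite white_state => uv.
have s'v : v \notin s.
  by move/unique_white_nbrP/(_ v): uv; rewrite eqxx inE => /andP[].
split=> [|x0 k]; first by rewrite rcons_uniq s'v.
rewrite size_rcons ltnS leq_eqVlt => /predU1P[Dk | lt_k]; last first.
  rewrite -{1}cats1 takel_cat ?(ltnW lt_k) // !nth_rcons lt_k.
  by rewrite (ltn_trans _ lt_k) //; apply: Fs.
(* Were [j.+2] an index of [s], then [v], white at that time too and adjacent to [u], would be the
   vertex stored there. Parity excludes the last index, leaving only [k]. *)
have Dj1 : j = k.
  have: ~~ (j.+2 < size s).
    apply/negP => lt_j2; have /unique_white_nbrP/(_ v) := Fs u j lt_j2.
    move/unique_white_nbrP/(_ v): uv; rewrite eqxx Dj !inE => /andP[_ ->].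
    rewrite (contra (@mem_take _ _ _ _) s'v) => /esym/eqP Dv.
    by case/negP: s'v; rewrite Dv mem_nth.
  by move: lt_j odd_j; rewrite -Dk; lia.
rewrite !nth_rcons -Dk ltnn eqxx -cats1 takel_cat ?Dk // take_size.
by rewrite -Dk ltnW // -Dj1 (set_nth_default u) // Dj.
Qed.

Lemma outcome11_forcing_order s : forcing_order s ->
  (1, 1) \in outcomes (state s 1 1) ->
  exists t, forcing_order t /\ forall x, x \in t.
Proof.
have [k] := ubnP #|white (state s 1 1)|; elim: k s => // k IHk s leWk Fs.
have [tP _ | ntP] := boolP (terminal (state s 1 1)).
  by exists s; split=> //; apply/terminal_state: tP.
case/(mem_outcomes _ ntP) => [[[v|u v] Lm]] p11 _.
  (* A further seed raises one counter to 2, and counters never decrease. *)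
  by have [] := outcomes_ge p11; rewrite play_seed /=; case: odd.
rewrite play_force in p11; apply: IHk p11; last exact: forcing_order_rcons Lm.
by rewrite -ltnS -(play_force s 1 1 u) -(white_play Lm).
Qed.

(** The rest of [s] is replayed by forces. No alternative can beat this line, since both counters
    already stand at 1. *)
Lemma forcing_order_outcome11 s k : forcing_order s -> (forall x, x \in s) ->
  2 <= k -> (1, 1) \in outcomes (state (take k s) 1 1).
Proof.
move=> [Us Fs] s_all; have [n] := ubnP (size s - k).
elim: n k => // n IHn k lt_n ge_k.
have [le_s | lt_k] := leqP (size s) k.
  by rewrite take_oversize // outcomesE (introT (terminal_state _ _ _)) ?inE.
have x0 : G by case: (s) lt_k.
have size_k : size (take k s) = k by rewrite size_takel // ltnW.
have Dk1 := take_nth x0 lt_k.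
have k'v : nth x0 s k \notin take k s.
  by have := take_uniq k.+1 Us; rewrite Dk1 rcons_uniq => /andP[].
apply/mem_outcomes.
  by apply/negP => /terminal_state k_all; rewrite k_all in k'v.
split=> [|m q _ /outcomes_ge[geA geB]].
  exists (Force (nth x0 s (k - 2)) (nth x0 s k)).
    apply/andP; split.
      apply/(own_state x0); exists (k - 2); rewrite size_k.
      by split; [lia | lia | rewrite nth_take //; lia].
    have Dk : (k - 2).+2 = k by lia.
    by rewrite white_state; have := Fs x0 (k - 2); rewrite Dk; apply.
  by rewrite play_force -Dk1 IHn //; lia.
have [leA leB] := seeds_play (state (take k s) 1 1) m.
by case: turn; [apply: leq_trans leA geA | apply: leq_trans leB geB].
Qed.

(** * The two opening turns *)

(** With at most one vertex coloured, the player to move owns none. *)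
Lemma opening_no_force s sA sB u v :
  size s <= 1 -> ~~ legal_force (state s sA sB) (turn (state s sA sB)) u v.
Proof.
by move=> le1; apply/negP => /andP[/(own_state u)[i [lt_i odd_i _]] _]; lia.
Qed.

Lemma opening_available s sA sB v :
  size s <= 1 -> available_seed (state s sA sB) v = (v \notin s).
Proof.
move=> le1; rewrite /available_seed white_state inE andbC.
case: existsP => //= -[u]; by rewrite (negPf (opening_no_force _ _ _ _ le1)).
Qed.

Lemma opening_seed s sA sB m : size s <= 1 ->
  legal_move (state s sA sB) m -> exists2 v, v \notin s & m = Seed v.
Proof.
move=> le1; case: m => [v|u v] /=; last first.
  by rewrite (negPf (opening_no_force _ _ _ _ le1)).
by rewrite opening_available // => /andP[s'v _]; exists v.
Qed.

Lemma nonterminal_state s sA sB :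
  size s < #|vertex G| -> ~~ terminal (state s sA sB).
Proof.
rewrite ltnNge; apply: contra => /terminal_state s_all.
by rewrite cardE uniq_leq_size ?enum_uniq.
Qed.

Lemma initial_outcomes p : 2 <= #|vertex G| -> p \in outcomes (initial G) ->
  exists v w, v != w /\ p \in outcomes (state [:: v; w] 1 1).
Proof.
move=> G2; rewrite initial_state => /(mem_outcomes _ (nonterminal_state _ _ _)).
case=> [|[m /opening_seed[//|v _ ->]]]; first exact: ltnW.
rewrite play_seed => /(mem_outcomes _ (nonterminal_state _ _ _))[//|].
case=> m' /opening_seed[//|w vw ->].
rewrite play_seed => pvw _ _; exists v, w; split=> //.
by move: vw; rewrite inE eq_sym.
Qed.

Lemma forcing_order_initial s : 2 <= #|vertex G| -> forcing_order s ->
  (forall x, x \in s) -> (1, 1) \in outcomes (initial G).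
Proof.
move=> G2 Fs s_all; have:= forcing_order_outcome11 Fs s_all (leqnn 2).
case: s Fs s_all => [|v [|w s]] [Us Fs] s_all.
- by move: G2; case: (pickP (vertex G)) => [x | /eq_card0->];
    first by have := s_all x.
- by have /terminal_state[] := nonterminal_state 0 0 (G2 : size [:: v] < _).
rewrite /= take0 => p11; rewrite initial_state.
apply/mem_outcomes; first exact/nonterminal_state/ltnW.
split=> [|m q /opening_seed[//|x _ ->]]; last first.
  by rewrite play_seed => /outcomes_ge[].
exists (Seed v).
  (* Bob owns no vertex yet, so the first seed blocks nothing. *)
  rewrite /= opening_available //=; apply/implyP => /existsP[u /existsP[x]].
  by case/andP => /andP[]; rewrite inE.
rewrite play_seed; apply/mem_outcomes; first exact: nonterminal_state.
split=> [|m q /opening_seed[//|x _ ->]]; last first.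
  by rewrite play_seed => /outcomes_ge[].
exists (Seed w); last by rewrite play_seed.
have vw : w \notin [:: v].
  by move: Us => /=; rewrite !inE eq_sym negb_or -!andbA => /andP[].
rewrite /legal_move opening_available // vw; apply/implyP => Bw.
apply/forallP => w1; rewrite opening_available //; apply/implyP => vw1.
(* If only [v] and [w] exist, every available seed [w1] is [w] and inherits the assumed blocking
   [Bw]. Otherwise [Bw] is contradicted. *)
case: s Us Fs s_all => [|x s] Us Fs s_all.
  have := s_all w1; rewrite in_cons -(mem_seq1 w1 v) (negPf vw1) mem_seq1.
  by move=> /eqP->; exact: Bw.
have {Fs} /= Fx := Fs v 0 isT.
case/existsP: Bw => u /existsP[y /andP[/andP[]]].
rewrite inE /= mem_seq1 => /eqP-> {u}.
rewrite white_state => /unique_white_nbrP Fy.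
(* The third vertex [x] is a white neighbour of [v] already before Bob's seed, so the allegedly
   blocked force [v] to [y] has [y = x]; but by [Fx] this force is still legal after [w] is
   seeded. *)
have := Fx => /unique_white_nbrP/(_ x).
rewrite eqxx inE in_cons negb_or => /andP[/andP[vx wx] adj_vx].
have /esym/eqP <- : true = (x == y) by rewrite -Fy inE mem_seq1 vx.
by rewrite play_seed /legal_force white_state Fx inE mem_head.
Qed.

(** * From forcing orders to alternating schedules *)

Lemma white_take k s :
  [set x : G | x \notin take (uphalf k) (evens s) ++ take k./2 (odds s)] =
  [set x | x \notin take k s].
Proof.
have [<- <-] := take_evens_odds k s.
by apply/setP => x; rewrite !inE (perm_mem (perm_evens_odds _)).
Qed.

(** Entry [i] of Alice's chain has index [i.*2] in [s] and entry [i] of Bob's has index [i.*2.+1];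
    by [white_take] the white sets of the schedule are then the complements of prefixes of [s]. *)
Lemma forcing_orderP s :
  forcing_order s /\ (forall x, x \in s) <->
  alternating_two_chain_schedule (evens s) (odds s).
Proof.
split=> [[[Us Fs] s_all] | [p_s _ _ Fa Fb]].
  have p_s : perm_eq s (enum (vertex G)).
    by apply: uniq_perm; rewrite ?enum_uniq // => x; rewrite mem_enum s_all.
  have size_s : size s = #|vertex G| by rewrite (perm_size p_s) -cardE.
  split.
  - exact: perm_trans (perm_evens_odds s) p_s.
  - by rewrite size_evens size_s.
  - by rewrite size_odds size_s.
  - move=> x0 [//|i] /=; rewrite size_evens !nth_evens => lt_i.
    have := white_take i.+1.*2 s; rewrite uphalf_double doubleK => ->.
    by rewrite doubleS; apply: Fs; lia.
  - move=> x0 [//|i] /=; rewrite size_odds !nth_odds => lt_i.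
    have := white_take i.+1.*2.+1 s; rewrite /= doubleK uphalf_double => ->.
    by rewrite doubleS; apply: Fs; lia.
have {}p_s : perm_eq s (enum (vertex G)).
  by rewrite -(permPl (perm_evens_odds s)).
split=> [|x]; last by rewrite (perm_mem p_s) mem_enum.
split=> [|x0 k lt_k]; first by rewrite (perm_uniq p_s) enum_uniq.
(* The parity of [k] tells whose chain the condition belongs to: odd for Bob, even for Alice. *)
rewrite -white_take -[k]odd_double_half; case odd_k: (odd k) => /=.
  have := Fb x0 k./2.+1; rewrite !nth_odds size_odds /= doubleS.
  by rewrite uphalf_double doubleK; apply; lia.
have := Fa x0 k./2.+1; rewrite !nth_evens size_evens /= doubleS.
by rewrite add0n uphalf_double doubleK; apply; lia.
Qed.

Lemma schedule_forcing_order :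
  admits_alternating_two_chain_schedule G <->
  exists s, forcing_order s /\ forall x, x \in s.
Proof.
split=> [[a [b ab]] | [s /forcing_orderP]]; last by exists (evens s), (odds s).
have [s [Da Db]] : exists s, evens s = a /\ odds s = b.
  by apply: evens_odds_surj; case: ab => _ -> -> _ _; lia.
by exists s; apply/forcing_orderP; rewrite Da Db.
Qed.

(** Both coordinates of every outcome are at least 1 because both openings are seeds, so a sum of 2
    can only come from (1, 1). *)
Lemma Zg_eq2 : 2 <= #|vertex G| ->
  Zg G = 2 <-> (1, 1) \in outcomes (initial G).
Proof.
move=> G2; have ge1 p : p \in outcomes (initial G) -> 1 <= p.1 /\ 1 <= p.2.
  by case/(initial_outcomes G2) => v [w [_ /outcomes_ge]].
have : Zg G \in [seq p.1 + p.2 | p <- outcomes (initial G)].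
  by apply: seq_min_mem; have := outcomes_neq0 (initial G); case: outcomes.
case/mapP => -[p1 p2] p_out DZ; have [/= ge1p ge2p] := ge1 _ p_out.
split=> [Z2 | o11].
  suff [D1 D2] : p1 = 1 /\ p2 = 1 by rewrite D1 D2 in p_out.
  by move: DZ; rewrite Z2 /=; lia.
apply: anti_leq; apply/andP; split; last by rewrite DZ /=; lia.
by apply: seq_min_le; apply/mapP; exists (1, 1).
Qed.

End Play.

Theorem theorem21 (G : sgraph) (G_connected : connected_graph G)
    (G_order : 2 <= #|vertex G|) :
  Zg G = 2 <-> admits_alternating_two_chain_schedule G.
Proof.
split=> [/(Zg_eq2 G_order)/(initial_outcomes G_order)[v [w [vw p11]]]|].
  apply/schedule_forcing_order; apply: outcome11_forcing_order p11.
  (* On the two opening vertices a forcing order demands only distinctness. *)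
  by split=> [|x0 k //]; rewrite /= inE vw.
case/schedule_forcing_order => s [Fs s_all].
by apply/(Zg_eq2 G_order); apply: forcing_order_initial Fs s_all.
Qed.
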